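(* There exist non-empty, compact subsets $F,G$ of $\mathbb{R}$ such that: (i) if $(\Phi_s)_{s\in(\dim_{\mathrm H}F,\underline{\dim}_{\mathrm B}F)}$ is any family of admissible functions such that $\overline{\dim}^{\Phi_s}F=s$ for all $s\in(\dim_{\mathrm H}F,\underline{\dim}_{\mathrm B}F)$, then the function $s\mapsto\overline{\dim}^{\Phi_s}G$ is not continuous on $(\dim_{\mathrm H}F,\underline{\dim}_{\mathrm B}F)$; and (ii) if $(\Psi_s)_{s\in(\dim_{\mathrm H}F,\underline{\dim}_{\mathrm B}F)}$ is any family of admissible functions such that $\underline{\dim}^{\Psi_s}F=s$ for all $s\in(\dim_{\mathrm H}F,\underline{\dim}_{\mathrm B}F)$, then the function $s\mapsto\underline{\dim}^{\Psi_s}G$ is not continuous on $(\dim_{\mathrm H}F,\underline{\dim}_{\mathrm B}F)$.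
   Context: $\mathbb{R}$ carries the Euclidean metric and $|U|$ denotes the diameter of $U$. Convention: $\inf\varnothing=\infty$. A function $\Phi\colon(0,\Delta)\to\mathbb{R}$ (for some $\Delta>0$) is admissible if it is monotonic, $0<\Phi(\delta)\le\delta$ for all $\delta\in(0,\Delta)$, and $\Phi(\delta)/\delta\to0$ as $\delta\to0^+$. For a non-empty bounded $F\subset\mathbb{R}$ and admissible $\Phi$, the upper $\Phi$-intermediate dimension $\overline{\dim}^\Phi F$ is the infimum of all $s\ge0$ such that for all $\epsilon>0$ there exists $\delta_0\in(0,1]$ (with $(0,\delta_0)$ contained in the domain of $\Phi$) such that for all $\delta\in(0,\delta_0)$ there is a finite or countable cover $\{U_1,U_2,\dots\}$ of $F$ by subsets of $\mathbb{R}$ with $\Phi(\delta)\le|U_i|\le\delta$ for all $i$ and $\sum_i|U_i|^s\le\epsilon$. The lower $\Phi$-intermediate dimension $\underline{\dim}^\Phi F$ is the infimum of all $s\ge0$ such that for all $\epsilon>0$ and $\delta_0\in(0,1]$ there exist $\delta\in(0,\delta_0)$ (in the domain of $\Phi$) and such a cover of $F$ with $\Phi(\delta)\le|U_i|\le\delta$ for all $i$ and $\sum_i|U_i|^s\le\epsilon$. $\dim_{\mathrm H}$ is Hausdorff dimension and $\underline{\dim}_{\mathrm B}$ is lower box dimension, $\underline{\dim}_{\mathrm B}F=\liminf_{\delta\to0^+}\log N_\delta(F)/(-\log\delta)$, where $N_\delta(F)$ is the smallest number of open balls of radius $\delta/2$ with centres in $F$ needed to cover $F$. *)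

(* Defs.v *)
From HB Require Import structures.
From mathcomp Require Import all_boot all_order all_algebra finmap.
From mathcomp Require Import all_classical all_reals all_analysis.

Set Implicit Arguments.
Unset Strict Implicit.
Unset Printing Implicit Defensive.

Import Order.TTheory GRing.Theory Num.Theory.
Import numFieldNormedType.Exports.

Local Open Scope classical_set_scope.
Local Open Scope ring_scope.

Section Dimensions.
Variable R : realType.
Implicit Types (U : nat -> set R) (D : set nat) (F : set R) (s : R).

(* Extended-real valued, so that an unbounded set has diameter +oo. The set
   [set 0] only serves to give the empty set diameter 0 rather than -oo. *)
Definition diam (A : set R) : \bar R :=
  ereal_sup ([set 0%E] `|` [set `|x - y|%:E | x in A & y in A]).

(* A finite or countable cover is a family indexed by an arbitrary D : set nat:
   finite families cannot be padded with empty sets, because the intermediate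
   dimensions bound the diameters from below by a positive number. *)
Definition covers D U F : Prop := F `<=` \bigcup_(i in D) U i.

Definition cover_cost s D U : \bar R := \esum_(i in D) (diam (U i) `^ s)%E.

(* Hausdorff measures on R. The only sets of diameter 0 are the empty set and
   the singletons; as 0 `^ 0 = 1, the measure for s = 0 counts points. *)
Definition hausdorff_premeasure s (delta : R) F : \bar R :=
  ereal_inf [set c | exists D U, [/\ covers D U F,
    forall i, D i -> (diam (U i) <= delta%:E)%E & c = cover_cost s D U]].

Definition hausdorff_measure s F : \bar R :=
  ereal_sup [set hausdorff_premeasure s delta F | delta in [set d | 0 < d]].

Definition hausdorff_dim F : \bar R :=
  ereal_inf [set s%:E | s in [set s | 0 <= s /\ hausdorff_measure s F = 0%E]].

(* +oo if no finite number of balls suffices. *)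
Definition covering_number (delta : R) F : \bar R :=
  ereal_inf [set (#|` C|%fset%:R : R)%:E | C in [set C : {fset R} |
    [set` C] `<=` F /\ F `<=` \bigcup_(x in [set` C]) ball x (delta / 2)]].

Definition lower_box_dim F : \bar R :=
  limf_einf (fun delta : R =>
    (lne (covering_number delta F) * ((- ln delta)^-1)%:E)%E) 0^'+.

(* phi is only meaningful on `]0, Delta[; its other values are irrelevant. *)
Definition admissible (Delta : R) (phi : R -> R) : Prop :=
  [/\ 0 < Delta,
      {in `]0, Delta[ &, {homo phi : x y / x <= y}} \/
      {in `]0, Delta[ &, {homo phi : x y /~ x <= y}},
      {in `]0, Delta[, forall delta, 0 < phi delta <= delta} &
      phi delta / delta @[delta --> 0^'+] --> (0 : R)].

Definition good_cover (phi : R -> R) s (eps delta : R) F : Prop :=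
  exists D U, [/\ covers D U F,
    forall i, D i -> ((phi delta)%:E <= diam (U i) <= delta%:E)%E &
    (cover_cost s D U <= eps%:E)%E].

Definition upper_intermediate_dim (Delta : R) (phi : R -> R) F : \bar R :=
  ereal_inf [set s%:E | s in [set s | 0 <= s /\
    forall eps, 0 < eps -> exists delta0,
      [/\ 0 < delta0 <= 1, delta0 <= Delta &
        forall delta, 0 < delta < delta0 -> good_cover phi s eps delta F]]].

Definition lower_intermediate_dim (Delta : R) (phi : R -> R) F : \bar R :=
  ereal_inf [set s%:E | s in [set s | 0 <= s /\
    forall eps delta0, 0 < eps -> 0 < delta0 <= 1 -> exists delta,
      [/\ 0 < delta < delta0, delta < Delta & good_cover phi s eps delta F]]].

Definition dim_interval F : set R :=
  [set s | (hausdorff_dim F < s%:E < lower_box_dim F)%E].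

End Dimensions.

(* Main.v *)
Require Import Defs.
From mathcomp Require Import all_boot all_order all_algebra finmap.
From mathcomp Require Import all_classical all_reals all_analysis.
From mathcomp Require Import ring lra zify.
Import Order.TTheory GRing.Theory Num.Theory.
Import numFieldNormedType.Exports.
Local Open Scope classical_set_scope.
Local Open Scope ring_scope.

(* Take G = {0} u {1/n : n >= 1} and F = A u G, where A is the union over k of
   finite approximations, down to scale 16^-(k + 2 k^2), of the part in
   [0, 16^-k] of the self-similar Cantor set of numbers whose base-16 digits
   are 0 or 1. The box dimension of A is 1/4, but covering a piece of A
   efficiently at an exponent r < 1/4 by sets of diameter at most delta needs
   diameters smaller than every power of delta. So if the Phi-dimension of F is
   below 1/4, Phi is super-polynomially small (at all small scales for the upper
   dimension, at arbitrarily small ones for the lower), and then covering G by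
   [0, delta] and fewer than 1/delta intervals of length Phi(delta) gives it a
   small dimension. If the Phi-dimension of F exceeds 1/4, then A cannot be
   responsible for it, and the dimension of G is at least 1/4. As F is countable
   and G has box dimension 1/2 (at least 1/3 is enough), the jump at 1/4 is inside the interval. *)

(** * Arithmetic of base-16 expansions with digits 0 and 1 *)

Section Spread.
Local Open Scope nat_scope.

(* Reads the m lowest binary digits of n as base-16 digits. *)
Fixpoint spread (m n : nat) : nat :=
  if m is m'.+1 then 16 * spread m' n./2 + odd n else 0.

(** The extreme case has all m digits equal to 1, with value (16^m - 1) / 15. *)
Lemma spread_lt m n : 15 * spread m n < 16 ^ m.
Proof.
elim: m n => [|m IHm] n //=; move: (IHm n./2); rewrite expnS.
by move: (16 ^ m) (spread _ _) => q a; case: (odd n) => h; lia.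
Qed.

Lemma spread0 m : spread m 0 = 0.
Proof. by elim: m => //= m ->. Qed.

Lemma half_divn n j : n./2 %/ 2 ^ j = n %/ 2 ^ j.+1.
Proof. by rewrite expnS divnMA divn2. Qed.

Lemma spreadD j m n : spread (j + m) n = 16 ^ j * spread m (n %/ 2 ^ j) + spread j n.
Proof.
elim: j n => [|j IHj] n; first by rewrite mul1n divn1 addn0.
by rewrite addSn /= IHj half_divn (expnS 16) mulnDr mulnA addnA.
Qed.

Lemma spread_mulX j u : spread j (u * 2 ^ j) = 0.
Proof.
elim: j u => [|j IHj] u //=.
rewrite expnS oddM oddM /= andbF addn0.
by rewrite mulnCA mul2n doubleK IHj.
Qed.

Lemma spread_small m k n : n < 2 ^ m -> 15 * spread (m + k) n < 16 ^ m.
Proof. by move=> nm; rewrite spreadD divn_small // spread0 muln0 spread_lt. Qed.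

Lemma spread_inj m u v :
  u < 2 ^ m -> v < 2 ^ m -> spread m u = spread m v -> u = v.
Proof.
elim: m u v => [|m IHm] u v; first by rewrite !ltnS !leqn0 => /eqP-> /eqP->.
rewrite expnS => um vm /= e.
have [eo es] : odd u = odd v /\ spread m u./2 = spread m v./2.
  by move: e; case: (odd u); case: (odd v) => /=; lia.
rewrite -(odd_double_half u) -(odd_double_half v) eo.
by congr (_ + _.*2); apply: IHm es; lia.
Qed.

(** If the parts above the j lowest digits differ, they contribute a gap of at least 16^j, while the
    low parts stay below 16^j / 15; the values are then more than 16^j / 2 apart. *)
Lemma spread_close m j u v : u < 2 ^ m -> v < 2 ^ m ->
  2 * spread m u <= 2 * spread m v + 16 ^ j ->
  2 * spread m v <= 2 * spread m u + 16 ^ j ->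
  u %/ 2 ^ j = v %/ 2 ^ j.
Proof.
move=> um vm; case: (leqP m j) => [mj _ _|/ltnW jm].
  by rewrite !divn_small //; [apply: leq_trans vm _|apply: leq_trans um _];
     rewrite leq_exp2l.
rewrite -(subnKC jm) !spreadD; move: (spread_lt j u) (spread_lt j v) => su sv.
move=> h1 h2; apply: (@spread_inj (m - j)).
- by rewrite ltn_divLR ?expn_gt0// -expnD subnK.
- by rewrite ltn_divLR ?expn_gt0// -expnD subnK.
move: h1 h2 su sv; set a := spread _ (u %/ _); set b := spread _ (v %/ _).
have : 0 < 16 ^ j by rewrite expn_gt0.
set q := 16 ^ j => q0 h1 h2 su sv.
by case: (ltngtP a b) => // ab; [have : q * a.+1 <= q * b by rewrite leq_mul2l ab orbT
  | have : q * b.+1 <= q * a by rewrite leq_mul2l ab orbT]; rewrite mulnS; lia.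
Qed.

(** [v] keeps the j leading digits of u out of m, or pads u with zeros when m is smaller. After
    division by 16^(m + j), the point of u lies in the interval of length 16^-j starting at the
    point of v. *)
Lemma spread_prefix m j u : u < 2 ^ m -> exists v, [/\ v < 2 ^ j,
  spread j v * 16 ^ m <= spread m u * 16 ^ j &
  spread m u * 16 ^ j <= (spread j v).+1 * 16 ^ m].
Proof.
move=> um; case: (leqP j m) => [jm|/ltnW mj].
  exists (u %/ 2 ^ (m - j)).
  rewrite ltn_divLR ?expn_gt0// -expnD subnKC// um.
  have := spreadD (m - j) j u; rewrite subnK// => ->.
  have := spread_lt (m - j) u.
  have -> : 16 ^ m = 16 ^ (m - j) * 16 ^ j by rewrite -expnD subnK.
  set q := 16 ^ (m - j); set a := spread j _.
  set r := 16 ^ j; set b := spread _ u => bq.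
  by split=> //; nia.
exists (u * 2 ^ (j - m)).
have := spreadD (j - m) m (u * 2 ^ (j - m)).
rewrite subnK// spread_mulX mulnK ?expn_gt0// addn0 => ->.
have -> : 16 ^ j = 16 ^ (j - m) * 16 ^ m by rewrite -expnD subnK.
set q := 16 ^ (j - m); set a := spread m u; set r := 16 ^ m.
split; [|nia|nia].
by rewrite -[in ltnRHS](subnKC mj) expnD ltn_mul2r um expn_gt0.
Qed.

Lemma count_divn_eq N q u : 0 < q -> \sum_(n < N | n %/ q == u) 1 <= q.
Proof.
move=> q0; rewrite sum1_card.
rewrite -[leqRHS]card_ord.
pose g (n : 'I_N) := Ordinal (ltn_pmod n q0).
apply: (@leq_card_in _ _ g) => m n => /eqP mu /eqP nu /(congr1 val) /= e.
by apply: val_inj => /=; rewrite (divn_eq m q) (divn_eq n q) mu nu e.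
Qed.

End Spread.

(** * Operations on covers with two-sided diameter bounds *)

Section Covers.
Variable R : realType.
Implicit Types (A B F U : set R) (phi : R -> R) (s eps delta : R).

Lemma le_diam U x y : U x -> U y -> (`|x - y|%:E <= diam U)%E.
Proof. by move=> Ux Uy; apply: ereal_sup_ubound; right; exists x => //; exists y. Qed.

Lemma diam_itv (a l : R) : 0 <= l -> diam `[a, a + l] = l%:E.
Proof.
move=> l0; apply/eqP; rewrite eq_le; apply/andP; split.
  apply: ge_ereal_sup => _ [->|[x /= + [y /= + <-]]]; first by rewrite lee_fin.
  by rewrite !in_itv /= lee_fin ler_norml => /andP[? ?] /andP[? ?]; lra.
have e : `|a + l - a| = l by rewrite addrC addKr ger0_norm.
have := @le_diam `[a, a + l]%classic (a + l) a; rewrite e; apply => /=.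
  by rewrite in_itv /= lerDl l0 lexx.
by rewrite in_itv /= lerDl l0 lexx.
Qed.

Lemma good_coverS phi s eps delta A B :
  A `<=` B -> good_cover phi s eps delta B -> good_cover phi s eps delta A.
Proof.
by move=> AB [D [U [cU dU sU]]]; exists D, U; split=> // x /AB; apply: cU.
Qed.

Lemma good_cover_le phi s eps1 eps2 delta A :
  eps1 <= eps2 -> good_cover phi s eps1 delta A -> good_cover phi s eps2 delta A.
Proof.
move=> e12 [D [U [cU dU sU]]]; exists D, U; split=> //.
by apply: le_trans sU _; rewrite lee_fin.
Qed.

(** All diameters lie in ]0, 1], where raising the exponent lowers each term. *)
Lemma good_cover_exponent phi r s eps delta A : r <= s -> delta <= 1 ->
  0 < phi delta -> good_cover phi r eps delta A -> good_cover phi s eps delta A.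
Proof.
move=> rs d1 p0 [D [U [cU dU sU]]]; exists D, U; split=> //.
apply: le_trans sU; apply: le_esum => i /dU /=.
case: (diam (U i)) => [d| |] //=; rewrite ?lee_fin ?andbF // => /andP[pd dd].
by rewrite ger_powR // (lt_le_trans p0 pd) (le_trans dd d1).
Qed.

(** Both index sets may be infinite, so they are interleaved: even indices carry the first cover,
    odd ones the second. *)
Lemma good_coverU phi s eps1 eps2 delta A B :
  good_cover phi s eps1 delta A -> good_cover phi s eps2 delta B ->
  good_cover phi s (eps1 + eps2) delta (A `|` B).
Proof.
move=> [D [U [cU dU sU]]] [E [V [cV dV sV]]].
pose W n := if odd n then V n./2 else U n./2.
pose DE := [set i.*2 | i in D] `|` [set i.*2.+1 | i in E].
exists DE, W; split.
- move=> x [/cU[i Di Ux]|/cV[i Ei Vx]].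
    by exists i.*2; [left; exists i|rewrite /W odd_double doubleK].
  by exists i.*2.+1; [right; exists i|rewrite /W /= odd_double /= uphalf_double].
- move=> _ [[i Di <-]|[i Ei <-]]; rewrite /W /= odd_double /= ?doubleK ?uphalf_double.
    exact: dU.
  exact: dV.
rewrite /cover_cost (esumID [set i.*2 | i in D]); last by move=> *; exact: poweR_ge0.
rewrite EFinD leeD//.
  apply: le_trans sU; rewrite (_ : _ `&` _ = [set i.*2 | i in D]); last first.
    by apply/seteqP; split=> [x []|x Dx] //; split=> //; left.
  rewrite esum_image; last by move=> i j _ _ /double_inj.
  by under eq_esum do rewrite /W odd_double doubleK.
apply: le_trans sV.
rewrite (_ : _ `&` _ = [set i.*2.+1 | i in E]); last first.
  apply/seteqP; split=> [x [[]//]|_ [i Ei <-]].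
  split; first by right; exists i.
  by move=> [j _] /(congr1 odd); rewrite /= !odd_double.
rewrite esum_image; last by move=> i j _ _ [] /double_inj.
by under eq_esum do rewrite /W /= odd_double /= uphalf_double.
Qed.

Lemma good_cover_itv phi s eps delta A n (a : nat -> R) l :
  0 <= l -> phi delta <= l <= delta ->
  (forall x, A x -> exists2 i, (i < n)%N & a i <= x <= a i + l) ->
  n%:R * l `^ s <= eps -> good_cover phi s eps delta A.
Proof.
move=> l0 ld cA nl; exists `I_n, (fun i => `[a i, a i + l]%classic); split.
- by move=> x /cA[i ni ax]; exists i => //=; rewrite in_itv.
- by move=> i _; rewrite diam_itv // !lee_fin.
rewrite /cover_cost; under eq_esum do rewrite diam_itv // poweR_EFin.
rewrite esum_fset; [|exact: finite_II|by move=> *; rewrite lee_fin powR_ge0].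
rewrite -fsbig_ord sumEFin big_const_ord iter_addr_0 lee_fin.
by rewrite -mulr_natl.
Qed.

End Covers.

(** * Covering costs of the harmonic set and of the Cantor-type set *)

Section Sets.
Variable R : realType.
Implicit Types (phi : R -> R) (r s t eps delta : R).

Lemma powR_quarter n : (16 ^+ n : R) `^ (1 / 4) = 2 ^+ n.
Proof.
have -> : 16 ^+ n = (2 ^+ n : R) `^ 4%:R.
  by rewrite powR_mulrn ?exprn_ge0// exprAC; congr (_ ^+ n); ring.
by rewrite -powRrM (_ : 4%:R * (1 / 4) = 1) ?powRr1 ?exprn_ge0//; field.
Qed.

Lemma ler_powR_quarter (a b : R) :
  0 <= a -> a <= b -> a `^ (1 / 4) <= b `^ (1 / 4).
Proof.
by move=> a0 ab; rewrite ge0_ler_powR ?nnegrE// (le_trans a0).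
Qed.

Lemma powR_small (a c : R) : 0 < a -> 0 < c ->
  exists delta1, 0 < delta1 <= 1 /\
    forall delta, 0 < delta < delta1 -> delta `^ a < c.
Proof.
move=> a0 c0; exists (Num.min 1 (c `^ a^-1)); split.
  by rewrite lt_min ltr01 powR_gt0// ge_min lexx.
move=> d /andP[d0]; rewrite lt_min => /andP[_ dc].
have -> : c = (c `^ a^-1) `^ a by rewrite -powRrM mulVf ?gt_eqF// powRr1// ltW.
by apply: gt0_ltr_powR => //; rewrite nnegrE ?powR_ge0 // ltW.
Qed.

Definition harmonic_set : set R := [set 0] `|` range (fun n => n.+1%:R^-1).

Lemma good_cover_harmonic phi s delta : 0 < phi delta <= delta ->
  good_cover phi s (delta `^ s + delta^-1 * phi delta `^ s) delta harmonic_set.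
Proof.
move=> /andP[p0 pd]; have d0 := lt_le_trans p0 pd.
pose N := Num.truncn delta^-1.
have dV0 : 0 <= delta^-1 by rewrite invr_ge0 ltW.
have /andP[Nd dN] := truncn_itv dV0.
pose G1 : set R := [set x | 0 <= x <= delta].
pose G2 : set R := [set x | exists2 n, (n < N)%N & x = n.+1%:R^-1].
apply: (@good_coverS _ _ _ _ _ _ (G1 `|` G2)).
  move=> _ [->|[n _ <-]]; first by left; rewrite /G1 /= lexx ltW.
  have [nN|Nn] := ltnP n N; first by right; exists n.
  (* Here 1/delta < N + 1 <= n + 1, so the tail of the sequence lies in [0, delta]. *)
  left; rewrite /G1 /= invr_ge0 ler0n /= invf_ple ?posrE ?ltr0n//.
  by apply: (le_trans (ltW dN)); rewrite ler_nat ltnS.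
apply: good_coverU.
  apply: (@good_cover_itv _ _ _ _ _ _ 1 (fun=> 0) delta).
  - exact: ltW.
  - by rewrite pd lexx.
  - by move=> x xd; exists 0%N => //; rewrite add0r.
  - by rewrite mul1r.
apply: (@good_cover_itv _ _ _ _ _ _ N (fun n => n.+1%:R^-1) (phi delta)).
- exact: ltW.
- by rewrite lexx pd.
- by move=> x [n nN ->]; exists n => //; rewrite lexx lerDl ltW.
- by rewrite ler_wpM2r ?powR_ge0.
Qed.

(** In piece k the first k digits are 0, which places it near 0, and the other 2 k^2 are free. The
    quadratic growth makes 16^-(2 k^2) eventually smaller than any fixed power of 16^-k. *)
Definition cantor_depth (k : nat) : nat := (k + 2 * k ^ 2)%N.

Definition cantor_point (m n : nat) : R := (spread m n)%:R / 16 ^+ m.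

Definition cantor_set : set R := [set x | exists k n,
  (n < 2 ^ (2 * k ^ 2))%N /\ x = cantor_point (cantor_depth k) n].

Lemma cantor_point_dist m u v (d : R) :
  `|cantor_point m u - cantor_point m v| <= d ->
  (spread m u)%:R <= (spread m v)%:R + d * 16 ^+ m.
Proof.
have p : 0 < 16 ^+ m :> R by rewrite exprn_gt0.
rewrite /cantor_point -mulrBl ler_norml => /andP[_].
by rewrite ler_pdivrMr// => h; rewrite -lerBlDl.
Qed.

(** Points of U agree in all but the j lowest digits, where 16^j is comparable to d * 16^m; so there
    are at most 2^j = (16^j)^(1/4) of them. *)
Lemma fiber_bound m N (U : set R) (d : R) (P : pred 'I_N) : (N <= 2 ^ m)%N ->
  diam U = d%:E -> 1 <= d * 16 ^+ m ->
  (forall n, P n -> U (cantor_point m n)) ->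
  (\sum_(n < N | P n) 1)%N%:R <= 4 * 2 ^+ m * d `^ (1 / 4).
Proof.
move=> Nm dU dm PU.
have p : 0 < 16 ^+ m :> R by rewrite exprn_gt0.
have d0 : 0 < d by rewrite -(pmulr_lgt0 _ p) (lt_le_trans ltr01 dm).
have [n0 Pn0|P0] := pickP P; last first.
  by rewrite big_pred0// !mulr_ge0 ?exprn_ge0 ?powR_ge0.
have ex : exists j, 2 * (d * 16 ^+ m) <= 16 ^+ j.
  exists (Num.bound (2 * (d * 16 ^+ m))).
  apply/ltW/(lt_le_trans (@upper_nthrootP _ _ _ (leqnn _))).
  by rewrite lerXn2r ?nnegrE ?ler_nat.
case: (ex_minnP ex) => j jd jmin.
have close n : P n -> (n %/ 2 ^ j = n0 %/ 2 ^ j)%N.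
  move=> Pn.
  have le1 u v : U (cantor_point m u) -> U (cantor_point m v) ->
      (2 * spread m u <= 2 * spread m v + 16 ^ j)%N.
    move=> Uu Uv; have := le_diam _ _ _ _ Uu Uv; rewrite dU lee_fin.
    move=> /cantor_point_dist uv.
    rewrite -(ler_nat R) natrD natrX !natrM; lra.
  by apply: (@spread_close m); rewrite ?(leq_trans (ltn_ord _))// ?le1//; apply: PU.
have le2j : (\sum_(n < N | P n) 1 <= 2 ^ j)%N.
  apply: leq_trans _ (count_divn_eq N (2 ^ j)%N (n0 %/ 2 ^ j)%N _); last by rewrite expn_gt0.
  rewrite big_mkcond [leqRHS]big_mkcond leq_sum// => n _; case: ifP => // /close ->.
  by rewrite eqxx.
apply: (@le_trans _ _ (2 ^+ j)); first by rewrite -natrX ler_nat.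
case: j jd jmin {close le2j} => [|j] jd jmin; first by rewrite expr0 in jd; lra.
(* Minimality of the exponent gives the factor 2; it is relaxed to 16, whose fourth root is
   exact. *)
have jd' : 16 ^+ j <= 16 ^+ m.+1 * d.
  have : ~~ (2 * (d * 16 ^+ m) <= 16 ^+ j).
    by apply/negP => /jmin; rewrite ltnn.
  rewrite -ltNge exprS => /ltW /le_trans; apply; nra.
have := ler_powR_quarter _ _ (exprn_ge0 _ (ler0n _ _)) jd'.
rewrite powRM ?exprn_ge0 ?(ltW d0)// !powR_quarter => h.
by move: h; rewrite !exprS -!mulrA; lra.
Qed.

(** Piece k has only 2^(2 k^2) points, whereas [fiber_bound] counts against 2^(k + 2 k^2); this
    ratio and the constant 4 give 2^(k+2). Used in the contrapositive, to force [phi delta] to be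
    tiny. *)
Lemma cantor_set_cost phi r delta k : r <= 1 / 4 -> 0 < phi delta ->
  good_cover phi r 1 delta cantor_set -> 1 <= phi delta * 16 ^+ cantor_depth k ->
  1 <= 2 ^+ k.+2 * delta `^ (1 / 4 - r).
Proof.
move=> r4 p0 [D [U [cU dU sU]]] pk.
set M := cantor_depth k in pk *; set m := (2 * k ^ 2)%N.
set eta := 1 / 4 - r; have eta0 : 0 <= eta by rewrite /eta; lra.
have /choice[i iP] : forall n : 'I_(2 ^ m), exists j,
    D j /\ U j (cantor_point M n).
  move=> n.
  have [|j Dj Uj] := @cU (cantor_point M n); last by exists j.
  by exists k, n; split=> //; exact: ltn_ord.
(* The finitely many cover members chosen for the points of piece k, each listed once. *)
pose I := undup (codom i).
have Ii n : i n \in I by rewrite mem_undup codom_f.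
have ID j : j \in I -> D j.
  by rewrite mem_undup => /codomP[n ->]; have [] := iP n.
have dfin j : D j -> exists d, [/\ diam (U j) = d%:E, phi delta <= d & d <= delta].
  move=> /dU; case: (diam (U j)) => [d| |] //=; rewrite ?lee_fin ?andbF //.
  by move=> /andP[]; exists d.
pose d j := fine (diam (U j)).
have sumI : \sum_(j <- I) d j `^ r <= 1.
  rewrite -lee_fin; apply: le_trans sU; apply: esum_ge.
  exists [set` I].
    by split; [exact: finite_seq|move=> j /= /ID].
  rewrite -fsbig_seq ?undup_uniq// -sumEFin big_seq [leRHS]big_seq.
  apply: lee_sum => j /ID /dfin [e [de _ _]].
  by rewrite /d de poweR_EFin.
(* Each U_j contains at most 4 * 2^M * |U_j|^(1/4) of the 2^m points, and
   |U_j|^(1/4) <= delta^eta * |U_j|^r; summing over j gives the bound. *)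
have fiber j : j \in I ->
    (\sum_(n < 2 ^ m | i n == j) 1)%N%:R <= 4 * 2 ^+ M * delta `^ eta * d j `^ r.
  move=> /ID /dfin [e [de pe ed]]; rewrite /d de /=.
  have e0 : 0 < e := lt_le_trans p0 pe.
  apply: (@le_trans _ _ (4 * 2 ^+ M * e `^ (1 / 4))).
    apply: fiber_bound de _ _.
    - by rewrite leq_exp2l// /M /cantor_depth leq_addl.
    - by apply: (le_trans pk); rewrite ler_pM2r ?exprn_gt0.
    - by move=> n /eqP <-; have [] := iP n.
  have -> : 1 / 4 = eta + r by rewrite /eta; ring.
  rewrite powRD; last by rewrite (gt_eqF e0) implybT.
  rewrite -!mulrA !ler_wpM2l ?exprn_ge0//.
  rewrite ler_wpM2r ?powR_ge0// ge0_ler_powR// nnegrE ltW//.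
  exact: lt_le_trans ed.
(* Each point is counted once, at the member chosen for it. *)
have tot : (2 ^ m = \sum_(j <- I) \sum_(n < 2 ^ m | i n == j) 1)%N.
  rewrite (exchange_big_dep xpredT)//=.
  rewrite (eq_bigr (fun=> 1%N)) ?sum1_card ?card_ord// => n _.
  under eq_bigl do rewrite eq_sym.
  rewrite sum1_count (count_uniq_mem (i n) (undup_uniq _ : uniq I)).
  by rewrite Ii.
have : (2 ^ m)%:R <= 4 * 2 ^+ M * delta `^ eta :> R.
  rewrite tot natr_sum; apply: (@le_trans _ _ (\sum_(j <- I) 4 * 2 ^+ M * delta `^ eta * d j `^ r)).
    by rewrite big_seq [leRHS]big_seq; apply: ler_sum => j /fiber.
  by rewrite -mulr_sumr ler_piMr// !mulr_ge0 ?exprn_ge0 ?powR_ge0.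
rewrite /M /cantor_depth -/m natrX exprD => h.
have m0 : 0 < 2 ^+ m :> R by rewrite exprn_gt0.
rewrite -(ler_pM2r m0) mul1r (le_trans h)// !exprS le_eqVlt; apply/orP; left.
by apply/eqP; ring.
Qed.

(** With 16^-(j+1) <= delta <= 16^-j, the 2^(j+1) intervals of length delta at the points with j + 1
    digits cover every piece, at cost at most 2 * delta^(t - 1/4). The threshold does not depend on
    [phi]. *)
Lemma good_cover_cantor_set t eps : 1 / 4 < t -> 0 < eps ->
  exists delta1, 0 < delta1 <= 1 /\ forall phi delta, 0 < delta < delta1 ->
    phi delta <= delta -> good_cover phi t eps delta cantor_set.
Proof.
move=> t4 e0.
have [||d1 [/andP[d10 d11] d1P]] := @powR_small (t - 1 / 4) (eps / 2).
- by rewrite subr_gt0.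
- by rewrite divr_gt0.
exists d1; rewrite d10 d11; split=> // phi d dd1 pd; have /andP[d0 dd] := dd1.
have ex : exists j, 1 <= 16 ^+ j * d.
  exists (Num.bound d^-1); rewrite -ler_pdivrMr// mul1r.
  apply/ltW/(lt_le_trans (@upper_nthrootP _ _ _ (leqnn _))).
  by rewrite lerXn2r ?nnegrE ?ler_nat.
case: (ex_minnP ex) => -[|j] jd jmin; first by rewrite mul1r in jd; lra.
have dlt : 16 ^+ j * d <= 1.
  by rewrite leNgt; apply/negP => /ltW /jmin; rewrite ltnn.
have := ler_powR_quarter _ _ (mulr_ge0 (exprn_ge0 _ (ler0n _ _)) (ltW d0)) dlt.
rewrite powRM ?exprn_ge0 ?(ltW d0)// !powR_quarter powR1 => h.
apply: (@good_cover_itv _ _ _ _ _ _ (2 ^ j.+1) (cantor_point j.+1) d).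
- exact: ltW.
- by rewrite pd lexx.
- move=> _ [k [n [nk ->]]].
  have [|v [vj v1 v2]] := @spread_prefix (cantor_depth k) j.+1 n.
    by rewrite (leq_trans nk)// leq_exp2l// /cantor_depth leq_addl.
  exists v => //; rewrite /cantor_point.
  have p q : 0 < 16 ^+ q :> R by rewrite exprn_gt0.
  apply/andP; split.
    by rewrite ler_pdivlMr// mulrAC ler_pdivrMr// -!natrX -!natrM ler_nat.
  apply: (@le_trans _ _ ((spread j.+1 v).+1%:R / 16 ^+ j.+1)).
    by rewrite ler_pdivlMr// mulrAC ler_pdivrMr// -!natrX -!natrM ler_nat.
  by rewrite -natr1 mulrDl lerD2l ler_pdivrMr// mulrC.
- rewrite natrX (_ : t = 1 / 4 + (t - 1 / 4)); last by ring.
  rewrite powRD; last by rewrite (gt_eqF d0) implybT.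
  have := d1P _ dd1; have : 0 <= d `^ (t - 1 / 4) by rewrite powR_ge0.
  rewrite exprS; move: (d `^ (t - 1 / 4)) (d `^ (1 / 4)) (2 ^+ j) h => a b c; nra.
Qed.

End Sets.

(** * From cheap covers of the Cantor-type set to cheap covers of the harmonic set *)

Lemma square_dominates P k : (4 * P < k -> k.+3 * P + k <= k ^ 2)%N.
Proof.
move=> Pk; have h : ((4 * P).+1 * k <= k * k)%N by rewrite leq_mul2r Pk orbT.
have h' : (P * 1 <= P * k)%N by rewrite leq_mul2l (leq_ltn_trans _ Pk) ?orbT.
by rewrite -mulnn; lia.
Qed.

(** The implication is between covers at one and the same delta, with a threshold independent of
    [phi]; it therefore serves the upper dimension (all small delta) and the lower one (some small
    delta) alike. *)
Lemma good_cover_harmonic_cantor (R : realType) (r eps : R) :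
  r < 1 / 4 -> 0 < eps ->
  exists delta1, 0 < delta1 <= 1 /\ forall (phi : R -> R) (delta : R), 0 < delta < delta1 ->
    0 < phi delta <= delta -> good_cover phi r 1 delta (cantor_set R) ->
    good_cover phi (1 / 8) eps delta (harmonic_set R).
Proof.
move=> r4 e0; set eta := 1 / 4 - r.
have eta0 : 0 < eta by rewrite subr_gt0.
pose P := Num.bound eta^-1.
have etaP : 1 <= eta * P%:R.
  by rewrite -ler_pdivrMl// mulr1 ltW// archi_boundP// invr_ge0 ltW.
(* The first bound feeds [square_dominates]; the second makes 2^k >= 2 / eps once k >= K. The
   threshold [d1] is chosen to ensure k >= K. *)
pose K := maxn (4 * P).+1 (Num.bound (2 / eps)).
have [||d1 [/andP[d10 d11] d1P]] := @powR_small R eta (2 ^+ K.+2)^-1.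
- exact: eta0.
- by rewrite invr_gt0 exprn_gt0.
have [||d2 [/andP[d20 d21] d2P]] := @powR_small R (1 / 8) (eps / 2).
- by rewrite divr_gt0.
- by rewrite divr_gt0.
exists (Num.min d1 d2); rewrite lt_min d10 d20 ge_min d11; split=> // phi d.
rewrite lt_min => /and3P[d0 dd1 dd2] pd gc; have /andP[p0 pd'] := pd.
have d1' : d <= 1 by rewrite ltW// (lt_le_trans dd1).
have := d1P d; have := d2P d; rewrite d0 dd1 dd2 => /(_ isT) h2 /(_ isT).
set w := d `^ eta; have w0 : 0 < w by rewrite powR_gt0.
rewrite -[_^-1]mul1r ltr_pdivlMr ?exprn_gt0// mulrC => wK.
have ex : exists k, 1 <= 2 ^+ k.+3 * w.
  exists (Num.bound w^-1); rewrite -ler_pdivrMr// mul1r.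
  apply/ltW/(lt_le_trans (@upper_nthrootP _ _ _ (leqnn _))).
  by rewrite ler_weXn2l ?ler1n// -addn3 leq_addr.
(* k is the largest integer with 2^(k+2) * delta^eta < 1, which forces
   phi delta < 16^-(k + 2 k^2), whereas 1/delta <= 2^((k+3) P). *)
case: (ex_minnP ex) => k kw kmin.
have Kk : (K <= k)%N.
  rewrite leqNgt; apply/negP => kK; move: wK; rewrite ltNge => /negP; apply.
  by apply: (le_trans kw); rewrite ler_pM2r// ler_weXn2l// ler1n.
have k1 : (4 * P < k)%N by rewrite (leq_trans _ Kk)// leq_maxl.
have kw' : 2 ^+ k.+2 * w < 1.
  rewrite ltNge; apply/negP; case: k kmin k1 {kw Kk} => // k kmin _ /kmin.
  by rewrite ltnn.
have pk : phi d * 16 ^+ (2 * k ^ 2) <= 1.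
  apply: (@le_trans _ _ (phi d * 16 ^+ cantor_depth k)).
    by rewrite ler_pM2l// ler_weXn2l ?ler1n// leq_addl.
  rewrite leNgt; apply/negP => /ltW.
  by move=> /(cantor_set_cost _ _ _ _ _ (ltW r4) p0 gc); rewrite leNgt kw'.
(* Eighth root of the previous bound, as 16^(2 k^2) = (2^(k^2))^8. *)
have {}pk : phi d `^ (1 / 8) * 2 ^+ (k ^ 2) <= 1.
  have -> : 2 ^+ (k ^ 2) = (16 ^+ (2 * k ^ 2) : R) `^ (1 / 8).
    have -> : 16 ^+ (2 * k ^ 2) = (2 ^+ (k ^ 2) : R) `^ 8%:R.
      rewrite powR_mulrn ?exprn_ge0// exprM [RHS]exprAC; congr (_ ^+ _); ring.
    by rewrite -powRrM (_ : 8%:R * (1 / 8) = 1) ?powRr1 ?exprn_ge0//; field.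
  rewrite -powRM ?exprn_ge0 ?(ltW p0)//.
  have e1 : 1 = 1 `^ (1 / 8) :> R by rewrite powR1.
  by rewrite [leRHS]e1 ge0_ler_powR// nnegrE ?mulr_ge0 ?exprn_ge0 ?(ltW p0).
(* Raise [kw] to the power P: since eta * P >= 1 and delta <= 1, w^P <= delta. *)
have dk : 1 <= 2 ^+ (k.+3 * P) * d.
  apply: (@le_trans _ _ ((2 ^+ k.+3 * w) ^+ P)); first by rewrite exprn_ege1.
  rewrite exprMn -exprM ler_pM2l ?exprn_gt0//.
  rewrite -powR_mulrn ?powR_ge0// -powRrM -[leRHS]powRr1 ?(ltW d0)//.
  by rewrite ger_powR// d0.
have ke : 1 <= 2 ^+ k * (eps / 2).
  rewrite -ler_pdivrMr ?divr_gt0// mul1r invf_div ltW//.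
  by apply: upper_nthrootP; rewrite (leq_trans _ Kk)// leq_maxr.
have kk : 2 ^+ (k.+3 * P) * 2 ^+ k <= 2 ^+ (k ^ 2) :> R.
  by rewrite -exprD ler_weXn2l ?ler1n// square_dominates.
apply: good_cover_le (good_cover_harmonic _ _ (1 / 8) _ pd).
suff : d^-1 * phi d `^ (1 / 8) <= eps / 2 by lra.
rewrite ler_pdivrMl//.
have := powR_ge0 (phi d) (1 / 8).
move: (phi d `^ (1 / 8)) pk => q pk q0.
(* Insert two factors that are at least 1 by [dk] and [ke]; [kk] then absorbs their powers of 2 into
   2^(k^2). *)
apply: (@le_trans _ _ (q * ((2 ^+ (k.+3 * P) * d) * (2 ^+ k * (eps / 2))))).
  rewrite ler_peMr//; nra.
apply: (@le_trans _ _ (q * 2 ^+ (k ^ 2) * (d * (eps / 2)))).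
  rewrite -[leRHS]mulrA ler_wpM2l// mulrACA ler_wpM2r// mulr_ge0 ?(ltW d0)// ltW//.
  by rewrite divr_gt0.
by rewrite ler_piMl// mulr_ge0 ?(ltW d0)// ltW// divr_gt0.
Qed.

(** * Compactness criterion and Hausdorff dimension of countable sets *)

Section Topology.
Variable R : realType.

(* S is the intersection over e > 0 of the closed sets
   [-e, e] u (S n [e, +oo[), the second part being finite. *)
Lemma compact_accumulating_at0 (S : set R) : S 0 ->
  (forall x, S x -> 0 <= x <= 1) ->
  (forall e : R, 0 < e -> finite_set (S `&` [set x | e <= x])) -> compact S.
Proof.
move=> S0 S1 Sfin.
apply: (subclosed_compact _ (@segment_compact R 0 1)); last first.
  by move=> x /S1 x01; rewrite /= in_itv.
have -> : S = \bigcap_(e in [set e : R | 0 < e])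
    ([set x | `|x| <= e] `|` (S `&` [set x | e <= x])).
  apply/seteqP; split=> x.
    move=> Sx e /= e0; have /andP[x0 _] := S1 _ Sx.
    by rewrite ger0_norm//; have [|/ltW] := leP x e; [left|right].
  move=> Sx; have [->//|x0] := eqVneq x 0.
  have x0' : 0 < `|x| by rewrite normr_gt0.
  have [/=|[]//] := Sx (`|x| / 2) (divr_gt0 x0' (ltr0Sn _ _)).
  lra.
apply: closed_bigI => e /= e0; apply: closedU.
  rewrite (_ : [set x | _] = `[- e, e]%classic); first exact: interval_closed.
  by apply/seteqP; split=> x /=; rewrite in_itv /= ler_norml.
have /accessible_finite_set_closed : accessible_space R.
  by apply: hausdorff_accessible; exact: Rhausdorff.
by apply; exact: Sfin.
Qed.

(** Cover by the fibres of an injection into the integers: each is empty or a singleton, so costs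
    0^e = 0 for every e > 0. *)
Lemma countable_hausdorff_dim (F : set R) : countable F -> (hausdorff_dim F <= 0)%E.
Proof.
move=> /countable_injP[f finj].
apply/lee_addgt0Pr => e e0; rewrite add0e.
apply: ge_ereal_inf; exists e%:E => //; exists e => //=; split; first exact: ltW.
apply/eqP; rewrite eq_le; apply/andP; split; last first.
  apply: le_trans (ereal_sup_ubound (x := hausdorff_premeasure e 1 F) _); last first.
    by exists 1 => //=.
  apply: le_ereal_inf_tmp => _ [D [U [_ _ ->]]].
  by apply: esum_ge0 => *; exact: poweR_ge0.
apply: ge_ereal_sup => _ [d /= d0 <-].
apply: ge_ereal_inf; exists 0%E => //.
have dU i : diam (F `&` f @^-1` [set i]) = 0%E.
  apply/eqP; rewrite eq_le; apply/andP; split; last by apply: ereal_sup_ubound; left.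
  apply: ge_ereal_sup => _ [->//|[x [Fx fx] [y [Fy fy] <-]]].
  by rewrite (finj x y) ?inE ?subrr ?normr0 //; rewrite /= in fx fy; rewrite fx fy.
exists setT, (fun i => F `&` f @^-1` [set i]); split.
- by move=> x Fx; exists (f x).
- by move=> i _; rewrite dU lee_fin ltW.
- rewrite /cover_cost esum1// => i _; rewrite dU poweR_EFin powR0// gt_eqF//.
Qed.

End Topology.

(** * Compactness, countability and box dimension of the two sets *)

Section Examples.
Variable R : realType.

Lemma compact_harmonic_set : compact (harmonic_set R).
Proof.
apply: compact_accumulating_at0; first by left.
  move=> _ [->|[n _ <-]]; first by rewrite lexx ler01.
  by rewrite invr_ge0 ler0n invf_le1 ?ltr0n// ler1n.
move=> e e0; apply: (@sub_finite_set _ _ [set n.+1%:R^-1 | n in `I_(Num.bound e^-1)]).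
  move=> _ [[->|[n _ <-]] /= ex]; first by lra.
  exists n => //=; rewrite ltnNge; apply/negP => en.
  have eV : e^-1 < n.+1%:R.
    apply: (@lt_le_trans _ _ (Num.bound e^-1)%:R).
      by rewrite archi_boundP// invr_ge0 ltW.
    by rewrite ler_nat (leq_trans en).
  by move: ex; rewrite leNgt invf_plt ?posrE ?ltr0n// eV.
by apply: finite_image; exact: finite_II.
Qed.

Definition cantor_piece k : set R :=
  [set cantor_point R (cantor_depth k) n | n in `I_(2 ^ (2 * k ^ 2))].

Lemma cantor_setE : cantor_set R = \bigcup_k cantor_piece k.
Proof.
apply/seteqP; split=> [_ [k [n [nk ->]]]|_ [k _ [n /= nk <-]]].
  by exists k => //; exists n.
by exists k, n.
Qed.

Lemma finite_cantor_piece k : finite_set (cantor_piece k).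
Proof. by apply: finite_image; exact: finite_II. Qed.

Lemma cantor_piece_bound k x : cantor_piece k x -> 0 <= x <= (16 ^+ k)^-1.
Proof.
move=> [n /= nk <-]; rewrite /cantor_point divr_ge0 ?ler0n ?exprn_ge0//=.
have := @spread_small _ k _ nk; rewrite addnC -/(cantor_depth k) => h.
rewrite ler_pdivrMr ?exprn_gt0// /cantor_depth exprD mulKf ?gt_eqF ?exprn_gt0//.
by rewrite -natrX ler_nat; move: h; rewrite /cantor_depth; lia.
Qed.

Lemma compact_cantor_set : compact (cantor_set R).
Proof.
rewrite cantor_setE; apply: compact_accumulating_at0.
- by exists 0%N => //; exists 0%N => //; rewrite /cantor_point spread0 mul0r.
- move=> x [k _ /cantor_piece_bound /andP[-> /=]] /le_trans; apply.
  by rewrite invf_le1 ?exprn_gt0// exprn_ege1// ler1n.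
move=> e e0.
apply: (@sub_finite_set _ _ (\bigcup_(k in `I_(Num.bound e^-1)) cantor_piece k)).
  move=> x [[k _ kx] /= ex]; exists k => //=; rewrite ltnNge; apply/negP => ek.
  have /andP[_ xk] := cantor_piece_bound _ _ kx.
  have : e <= (16 ^+ k)^-1 by apply: le_trans xk.
  rewrite leNgt invf_plt ?posrE ?exprn_gt0// => /negP; apply.
  apply: (lt_le_trans (@upper_nthrootP _ _ _ ek)).
  by rewrite lerXn2r ?nnegrE ?ler_nat.
apply: bigcup_finite; first exact: finite_II.
by move=> k _; exact: finite_cantor_piece.
Qed.

Lemma countable_cantor_harmonic : countable (cantor_set R `|` harmonic_set R).
Proof.
have cU (A B : set R) : countable A -> countable B -> countable (A `|` B).
  by move=> cA cB; rewrite -bigcup2E; apply: bigcup_countable => // -[|[|]].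
apply: (cU _ _).
  rewrite cantor_setE; apply: bigcup_countable => // k _.
  by apply: finite_set_countable; exact: finite_cantor_piece.
apply: (cU _ _); first by apply: finite_set_countable; exact: finite_set1.
by rewrite -bigcup_imset1; apply: bigcup_countable.
Qed.

(** For m < n <= N, 1/m - 1/n >= 1/(m n) >= 1/N^2 >= delta, so no open ball of radius delta/2
    contains two of the points 1, 1/2, ..., 1/N. *)
Lemma covering_number_harmonic (F : set R) (delta : R) N :
  harmonic_set R `<=` F -> 0 < delta -> N%:R ^+ 2 * delta <= 1 ->
  (N%:R%:E <= covering_number delta F)%E.
Proof.
move=> GF d0 Nd; apply: le_ereal_inf_tmp => _ [C [_ cov] <-].
rewrite lee_fin ler_nat.
have /choice[g gP] : forall n : 'I_N, exists c, c \in C /\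
    ball c (delta / 2) (n.+1%:R^-1 : R).
  move=> n; have [|c /= Cc cn] := cov n.+1%:R^-1; last by exists c.
  by apply: GF; right; exists n.
have gneq (m n : 'I_N) : (m < n)%N -> g m <> g n.
  move=> mn e; have [_] := gP m; have [_] := gP n; rewrite -e.
  rewrite /ball /= => h1 h2.
  have : (m.+1%:R^-1 : R) - n.+1%:R^-1 < delta.
    move: h1 h2; rewrite !ltr_norml.
    by move: (m.+1%:R^-1) (n.+1%:R^-1) => u v /andP[? ?] /andP[? ?]; lra.
  apply/negP; rewrite -leNgt.
  have mN : (m.+1%:R : R) <= N%:R by rewrite ler_nat.
  have nN : (n.+1%:R : R) <= N%:R by rewrite ler_nat.
  have m0 : (0 : R) < m.+1%:R by rewrite ltr0n.
  have n0 : (0 : R) < n.+1%:R by rewrite ltr0n.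
  have mn1 : (m.+1%:R : R) + 1 <= n.+1%:R by rewrite natr1 ler_nat.
  have -> : (m.+1%:R^-1 : R) - n.+1%:R^-1 = (n.+1%:R - m.+1%:R) / (m.+1%:R * n.+1%:R).
    by field; rewrite !gt_eqF.
  rewrite ler_pdivlMr ?mulr_gt0//.
  apply: (@le_trans _ _ 1); last by lra.
  apply: le_trans Nd; rewrite mulrC ler_pM2r// expr2.
  by apply: ler_pM => //; exact: ltW.
have ginj : injective g.
  move=> m n e; apply: val_inj.
  case: (ltngtP (val m) (val n)) => // h; first by case: (gneq _ _ h).
  by case: (gneq _ _ h).
have := @uniq_leq_size _ (codom g) C; rewrite size_codom card_ord; apply.
  by rewrite map_inj_uniq ?enum_uniq.
by move=> _ /codomP[n ->]; have [] := gP n.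
Qed.

(** Apply the previous bound with N just above y = delta^(-1/3). For delta < 1/27 one has y > 3,
    hence N^2 <= (y + 1)^2 <= y^3 = 1/delta. *)
Lemma lower_box_dim_harmonic (F : set R) : harmonic_set R `<=` F ->
  ((1 / 3)%:E <= lower_box_dim F)%E.
Proof.
move=> GF; rewrite /lower_box_dim limf_einfE.
apply: ereal_sup_ge; eexists; first exists [set d : R | 0 < d < 27^-1] => //.
  have d27 : (0 : R) < 27^-1 by rewrite invr_gt0.
  have := nbhs_right_lt d27; have := nbhs_right_gt (0 : R).
  by apply: filterS2 => d /= -> ->.
apply: le_ereal_inf_tmp => _ [d /= /andP[d0 d27] <-].
set y := d^-1 `^ (1 / 3).
have dV0 : 0 < d^-1 by rewrite invr_gt0.
have y3 : y ^+ 3 = d^-1.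
  rewrite -powR_mulrn ?powR_ge0// -powRrM (_ : 1 / 3 * 3%:R = 1); last by field.
  by rewrite powRr1// ltW.
have y0 : 0 < y by rewrite powR_gt0.
have y27 : 27 < y ^+ 3 by rewrite y3 -[27]invrK ltf_pV2 ?posrE ?invr_gt0.
have yge3 : 3 <= y.
  rewrite leNgt; apply/negP => y_3; nra.
pose N := (Num.truncn y).+1.
have yN : y <= N%:R by rewrite ltW// truncnS_gt.
have Ny : N%:R <= y + 1.
  by rewrite /N -natr1 lerD2r; have /andP[] := truncn_itv (ltW y0).
have Nd : N%:R ^+ 2 * d <= 1.
  rewrite -ler_pdivlMr// mul1r -y3.
  apply: (@le_trans _ _ ((y + 1) ^+ 2)); first by rewrite lerXn2r ?nnegrE; lra.
  nra.
have cN := covering_number_harmonic F d N GF d0 Nd.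
have lnd : 0 < - ln d by rewrite oppr_gt0 ln_lt0// d0/=; lra.
have ycov : (y%:E <= covering_number d F)%E by apply: le_trans cN; rewrite lee_fin.
have : (lne y%:E <= lne (covering_number d F))%E.
  rewrite lee_lne ?in_itv/= ?leey ?lee_fin ?andbT ?(ltW y0)//.
  by apply: le_trans ycov; rewrite lee_fin ltW.
rewrite lne_EFin// /y ln_powR lnV ?posrE// => h.
apply: le_trans (lee_wpmul2r _ h); last by rewrite lee_fin invr_ge0 ltW.
by rewrite -EFinM mulfK ?gt_eqF.
Qed.

End Examples.

(** * Comparison of the intermediate dimensions on both sides of 1/4 *)

Section Dims.
Variable R : realType.
Implicit Types (Delta s : R) (phi : R -> R).

Lemma admissible_bound Delta phi delta :
  admissible Delta phi -> 0 < delta < Delta -> 0 < phi delta <= delta.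
Proof. by move=> [_ _ h _] d; apply: h; rewrite in_itv. Qed.

Lemma upper_dim_harmonic_le Delta phi :
  admissible Delta phi ->
  (upper_intermediate_dim Delta phi (cantor_set R `|` harmonic_set R) < (1 / 4)%:E)%E ->
  (upper_intermediate_dim Delta phi (harmonic_set R) <= (1 / 8)%:E)%E.
Proof.
move=> adm /ereal_inf_lt[_ [r /= [r0 rP] <-]]; rewrite lte_fin => r4.
apply: ge_ereal_inf; exists (1 / 8)%:E => //; exists (1 / 8) => //=.
split=> [|eps e0]; first by rewrite divr_ge0.
have [d1 [/andP[d10 d11] d1P]] := good_cover_harmonic_cantor R r eps r4 e0.
(* Cost bound 1 is what [good_cover_harmonic_cantor] asks of the Cantor part; the arbitrary eps
   enters only through [d1]. *)
have [d2 [/andP[d20 d21] d2D d2P]] := rP 1 ltr01.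
exists (Num.min d1 d2); split.
- by rewrite lt_min d10 d20 ge_min d11.
- by rewrite ge_min d2D orbT.
move=> d; rewrite lt_min => /and3P[d0 dd1 dd2].
apply: d1P; first by rewrite d0.
  by apply: admissible_bound adm _; rewrite d0 (lt_le_trans dd2).
by apply: good_coverS (d2P d _); [exact: subsetUl|rewrite d0].
Qed.

Lemma lower_dim_harmonic_le Delta phi :
  admissible Delta phi ->
  (lower_intermediate_dim Delta phi (cantor_set R `|` harmonic_set R) < (1 / 4)%:E)%E ->
  (lower_intermediate_dim Delta phi (harmonic_set R) <= (1 / 8)%:E)%E.
Proof.
move=> adm /ereal_inf_lt[_ [r /= [r0 rP] <-]]; rewrite lte_fin => r4.
apply: ge_ereal_inf; exists (1 / 8)%:E => //; exists (1 / 8) => //=.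
split=> [|eps d0 e0 /andP[d00 d01]]; first by rewrite divr_ge0.
have [d1 [/andP[d10 d11] d1P]] := good_cover_harmonic_cantor R r eps r4 e0.
have [||d [/andP[dgt0]]] := rP 1 (Num.min d0 d1) => //.
  by rewrite lt_min d00 d10 ge_min d01.
rewrite lt_min => /andP[dd0 dd1] dD gc; exists d; rewrite dgt0; split=> //.
apply: d1P; first by rewrite dgt0.
  by apply: admissible_bound adm _; rewrite dgt0.
by apply: good_coverS gc; exact: subsetUl.
Qed.

(** At exponent t > 1/4 the Cantor part costs at most eps / 2 at every small delta, and the harmonic
    cover for r still works for t. *)
Lemma good_cover_cantor_harmonic (r t eps : R) :
  r < 1 / 4 -> 1 / 4 < t -> 0 < eps ->
  exists delta1, 0 < delta1 <= 1 /\
    forall (phi : R -> R) (delta : R), 0 < delta < delta1 ->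
    0 < phi delta <= delta -> good_cover phi r (eps / 2) delta (harmonic_set R) ->
    good_cover phi t eps delta (cantor_set R `|` harmonic_set R).
Proof.
move=> r4 t4 e0.
have [|d1 [/andP[d10 d11] d1P]] := good_cover_cantor_set R t (eps / 2) t4.
  by rewrite divr_gt0.
exists d1; rewrite d10 d11; split=> // phi d dd1 /andP[p0 pd] gc.
have /andP[_ dd1'] := dd1.
rewrite [eps]splitr; apply: good_coverU; first exact: d1P.
apply: good_cover_exponent gc => //; first by lra.
by rewrite ltW// (lt_le_trans dd1').
Qed.

Lemma upper_dim_harmonic_ge Delta phi s : admissible Delta phi -> 1 / 4 < s ->
  upper_intermediate_dim Delta phi (cantor_set R `|` harmonic_set R) = s%:E ->
  ((1 / 4)%:E <= upper_intermediate_dim Delta phi (harmonic_set R))%E.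
Proof.
move=> adm s4 sE; rewrite leNgt; apply/negP.
move=> /ereal_inf_lt[_ [r /= [r0 rP] <-]]; rewrite lte_fin => r4.
(* A midpoint strictly between 1/4 and s: covers at exponent t would bound the dimension of the
   union by t < s. *)
pose t := (1 / 4 + s) / 2; have t4 : 1 / 4 < t by rewrite /t; lra.
suff : (s%:E <= t%:E)%E by rewrite lee_fin /t; lra.
rewrite -sE; apply: ge_ereal_inf; exists t%:E => //; exists t => //=.
split=> [|eps e0]; first by lra.
have [d1 [/andP[d10 d11] d1P]] := good_cover_cantor_harmonic r t eps r4 t4 e0.
have [|d2 [/andP[d20 d21] d2D d2P]] := rP (eps / 2); first by rewrite divr_gt0.
exists (Num.min d1 d2); split.
- by rewrite lt_min d10 d20 ge_min d11.
- by rewrite ge_min d2D orbT.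
move=> d; rewrite lt_min => /and3P[d0 dd1 dd2].
apply: d1P; first by rewrite d0.
  by apply: admissible_bound adm _; rewrite d0 (lt_le_trans dd2).
by apply: d2P; rewrite d0.
Qed.

Lemma lower_dim_harmonic_ge Delta phi s : admissible Delta phi -> 1 / 4 < s ->
  lower_intermediate_dim Delta phi (cantor_set R `|` harmonic_set R) = s%:E ->
  ((1 / 4)%:E <= lower_intermediate_dim Delta phi (harmonic_set R))%E.
Proof.
move=> adm s4 sE; rewrite leNgt; apply/negP.
move=> /ereal_inf_lt[_ [r /= [r0 rP] <-]]; rewrite lte_fin => r4.
pose t := (1 / 4 + s) / 2; have t4 : 1 / 4 < t by rewrite /t; lra.
suff : (s%:E <= t%:E)%E by rewrite lee_fin /t; lra.
rewrite -sE; apply: ge_ereal_inf; exists t%:E => //; exists t => //=.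
split=> [|eps d0 e0 /andP[d00 d01]]; first by lra.
have [d1 [/andP[d10 d11] d1P]] := good_cover_cantor_harmonic r t eps r4 t4 e0.
have [||d [/andP[dgt0]]] := rP (eps / 2) (Num.min d0 d1).
- by rewrite divr_gt0.
- by rewrite lt_min d00 d10 ge_min d01.
rewrite lt_min => /andP[dd0 dd1] dD gc; exists d; rewrite dgt0; split=> //.
apply: d1P => //; first by rewrite dgt0.
by apply: admissible_bound adm _; rewrite dgt0.
Qed.

Lemma dim_interval_cantor_harmonic s :
  0 < s < 1 / 3 -> dim_interval (cantor_set R `|` harmonic_set R) s.
Proof.
move=> /andP[s0 s3]; apply/andP; split.
  apply: (@le_lt_trans _ _ 0%E); last by rewrite lte_fin.
  exact/countable_hausdorff_dim/countable_cantor_harmonic.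
apply: (@lt_le_trans _ _ (1 / 3)%:E); first by rewrite lte_fin.
by apply: lower_box_dim_harmonic; exact: subsetUr.
Qed.

(** If h b < v, continuity gives h < v just to the right of b; otherwise u < v <= h b and h > u just
    to the left. Both contradict the bounds. *)
Lemma jump_not_continuous (D : set R) (h : R -> \bar R) (a b c : R) (u v : \bar R) :
  a < b < c -> (u < v)%E -> (forall s, a < s < c -> D s) ->
  (forall s, a < s < b -> (h s <= u)%E) ->
  (forall s, b < s < c -> (v <= h s)%E) -> ~ {within D, continuous h}.
Proof.
move=> /andP[ab bc] uv Dac hu hv /(@continuous_subspaceW _ _ `]a, c[%classic D h).
have sub : `]a, c[%classic `<=` D by move=> s; rewrite /= in_itv /=; exact: Dac.
move=> /(_ sub); rewrite continuous_open_subspace; last exact: interval_open.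
move=> /(_ b); rewrite inE /= in_itv /= ab bc => /(_ isT) hb.
have {}hb : h x @[x --> b] --> h b := hb.
have [hbv|vhb] := ltP (h b) v.
  have hlt : \forall x \near b^'+, (h x < v)%E.
    have nv : nbhs (h b) [set y | (y < v)%E].
      by apply: open_nbhs_nbhs; split => //; exact: open_ereal_lt_ereal.
    exact: (cvg_at_right_filter hb nv).
  have : \forall x \near b^'+, False; last by move/filter_ex => [].
  have := nbhs_right_lt bc; have := nbhs_right_gt b; move: hlt.
  apply: filterS3 => x hx bx xc.
  by have := hv x; rewrite bx xc leNgt hx => /(_ isT).
have hgt : \forall x \near b^'-, (u < h x)%E.
  have nu : nbhs (h b) [set y | (u < y)%E].
    apply: open_nbhs_nbhs; split; [exact: open_ereal_gt_ereal|].
    exact: lt_le_trans vhb.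
  exact: (cvg_at_left_filter hb nu).
have : \forall x \near b^'-, False; last by move/filter_ex => [].
have := nbhs_left_gt ab; have := nbhs_left_lt b; move: hgt.
apply: filterS3 => x hx xb ax.
by have := hu x; rewrite ax xb leNgt hx => /(_ isT).
Qed.

End Dims.

Theorem proposition6p2 (R : realType) :
  exists F G : set R,
    [/\ F !=set0 /\ compact F,
        G !=set0 /\ compact G,
        forall (Delta : R -> R) (Phi : R -> R -> R),
          (forall s, dim_interval F s -> admissible (Delta s) (Phi s)) ->
          (forall s, dim_interval F s ->
             upper_intermediate_dim (Delta s) (Phi s) F = s%:E) ->
          ~ {within dim_interval F, continuous
               (fun s : R => upper_intermediate_dim (Delta s) (Phi s) G)} &
        forall (Delta : R -> R) (Psi : R -> R -> R),
          (forall s, dim_interval F s -> admissible (Delta s) (Psi s)) ->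
          (forall s, dim_interval F s ->
             lower_intermediate_dim (Delta s) (Psi s) F = s%:E) ->
          ~ {within dim_interval F, continuous
               (fun s : R => lower_intermediate_dim (Delta s) (Psi s) G)}].
Proof.
have G0 : harmonic_set R 0 by left.
(* The jump is at 1/4 inside ]0, 1/3[, from values at most 1/8 to values at least 1/4. *)
have lt13 : 0 < (1 / 4 : R) < 1 / 3 by lra.
have lt84 : ((1 / 8)%:E < (1 / 4)%:E :> \bar R)%E by rewrite lte_fin; lra.
exists (cantor_set R `|` harmonic_set R), (harmonic_set R); split.
- split; first by exists 0; right.
  exact: compactU (compact_cantor_set R) (compact_harmonic_set R).
- by split; [exists 0|exact: compact_harmonic_set].
- move=> Delta Phi adm dimF.
  apply: (jump_not_continuous _ _ _ _ _ _ _ _ lt13 lt84) => s.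
  + exact: dim_interval_cantor_harmonic.
  + move=> /andP[s0 s4]; have Ds : dim_interval (cantor_set R `|` harmonic_set R) s.
      by apply: dim_interval_cantor_harmonic; lra.
    by apply: upper_dim_harmonic_le; [exact: adm|rewrite dimF// lte_fin].
  + move=> /andP[s4 s3]; have Ds : dim_interval (cantor_set R `|` harmonic_set R) s.
      by apply: dim_interval_cantor_harmonic; lra.
    exact: upper_dim_harmonic_ge (adm _ Ds) s4 (dimF _ Ds).
- move=> Delta Psi adm dimF.
  apply: (jump_not_continuous _ _ _ _ _ _ _ _ lt13 lt84) => s.
  + exact: dim_interval_cantor_harmonic.
  + move=> /andP[s0 s4]; have Ds : dim_interval (cantor_set R `|` harmonic_set R) s.
      by apply: dim_interval_cantor_harmonic; lra.
    by apply: lower_dim_harmonic_le; [exact: adm|rewrite dimF// lte_fin].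
  + move=> /andP[s4 s3]; have Ds : dim_interval (cantor_set R `|` harmonic_set R) s.
      by apply: dim_interval_cantor_harmonic; lra.
    exact: lower_dim_harmonic_ge (adm _ Ds) s4 (dimF _ Ds).
Qed.
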